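(* Let $\mathfrak g$ be a classical simple Lie algebra, let $\mathbf e=(e_1,e_2)$ be the model distinguished nilpotent pair in $\mathfrak g$ attached to diagrams $\Gamma^1,\Gamma^2,\Gamma^3$ as described in the context, with associated semisimple pair $\mathbf h=(h_1,h_2)$, and let $(p,q)\in\mathbb Q^2$ with $(p,q)\neq(0,0)$. Then the subspace $Z_{p,q}(\mathbf e)$ has a basis indexed by the finite set $\mathcal E_{p,q}(\mathbf e)$.
   Context: Diagrams. A diagram is a subset $\Gamma\subset\mathbb R^2$ with $\Gamma\subset\mathbb Z^2+(x,y)$ for some $x,y\in\mathbb R$. It is connected if any two of its elements are joined by a finite sequence of elements of $\Gamma$ with consecutive elements at Euclidean distance $1$. A skew diagram is a finite connected diagram $\Gamma$ such that $(i,j),(i+1,j+1)\in\Gamma$ implies $(i+1,j),(i,j+1)\in\Gamma$; skew diagrams are non-empty unless emptiness is explicitly allowed. Let $\sigma(i,j)=(-i,-j)$. A skew subdiagram of a skew diagram $\Gamma$ is a (non-empty) subset $\Gamma'\subset\Gamma$ which is a skew diagram and such that $(i,j)\in\Gamma'$ implies $(i-1,j),(i,j-1)\notin\Gamma\setminus\Gamma'$. A $\sigma$-skew subdiagram of $\Gamma$ is a subset $\Gamma'\subset\Gamma$ such that $\sigma(\Gamma')$ is a skew subdiagram of $\sigma(\Gamma)$. A skew diagram is centrally symmetric if $\sigma(\Gamma)=\Gamma$; it is then integral if $\Gamma\subset\mathbb Z^2$, semi-integral if $\Gamma\subset\mathbb Z^2+(1/2,0)$ or $\Gamma\subset\mathbb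 Z^2+(0,1/2)$, non-integral if $\Gamma\subset\mathbb Z^2+(1/2,1/2)$. Model pairs. $K$ is an algebraically closed field of characteristic $0$; $\mathfrak g$ is a classical simple Lie algebra over $K$. The diagram data are as follows. Type A: a skew diagram $\Gamma=\Gamma^1$ with $|\Gamma|=\mathrm{rk}\,\mathfrak g+1$ and $\sum_{(i,j)\in\Gamma}i=\sum_{(i,j)\in\Gamma}j=0$; $\Gamma^2=\Gamma^3=\emptyset$. Type B: centrally symmetric skew diagrams $\Gamma^1$ integral, $\Gamma^2$ non-integral (empty allowed), $|\Gamma^1|+|\Gamma^2|=2\,\mathrm{rk}\,\mathfrak g+1$; $\Gamma^3=\emptyset$. Type C: centrally symmetric skew diagrams $\Gamma^1\subset\mathbb Z^2+(0,1/2)$, $\Gamma^2\subset\mathbb Z^2+(1/2,0)$ (empty allowed), $|\Gamma^1|+|\Gamma^2|=2\,\mathrm{rk}\,\mathfrak g$; $\Gamma^3=\emptyset$. Type D: centrally symmetric skew diagrams $\Gamma^1,\Gamma^2,\Gamma^3$ (empty allowed) with $|\Gamma^1|+|\Gamma^2|+|\Gamma^3|=2\,\mathrm{rk}\,\mathfrak g$, $\Gamma^1$ non-integral, and either $\Gamma^2=\Gamma^3=\emptyset$, or $\Gamma^2,\Gamma^3$ both non-empty and integral with $\Gamma^2\cap\Gamma^3=\{(0,0)\}\neq\Gamma^3$. Let $V=V_1\oplus V_2\oplus V_3$ with $V_k=\bigoplus_{(i,j)\in\Gamma^k}K v^k_{i,j}$, and put $v^k_{i,j}=0$ if $(i,j)\notin\Gamma^k$.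 Set $h_1v^k_{i,j}=i\,v^k_{i,j}$, $h_2v^k_{i,j}=j\,v^k_{i,j}$. Type A: $\mathfrak g=\mathfrak{sl}(V)$, $e_1v^1_{i,j}=v^1_{i+1,j}$, $e_2v^1_{i,j}=v^1_{i,j+1}$. Types B, D: $\mathfrak g=\mathfrak{so}(V)$ for the symmetric form $(v^n_{i,j},v^m_{k,l})=\delta_{i,-k}\delta_{j,-l}\delta_{n,m}$; $e_1v^k_{i,j}=(-1)^{i+j}v^k_{i+1,j}$, $e_2v^k_{i,j}=(-1)^{i+j+1}v^k_{i,j+1}$. Type C: $\mathfrak g=\mathfrak{sp}(V)$ for the alternating form $(v^n_{i,j},v^m_{k,l})=(-1)^{i+j+1/2}\delta_{i,-k}\delta_{j,-l}\delta_{n,m}$; $e_1v^k_{i,j}=v^k_{i+1,j}$, $e_2v^k_{i,j}=v^k_{i,j+1}$. Put $Z(\mathbf e)=\{x\in\mathfrak g:[x,e_1]=[x,e_2]=0\}$ and $Z_{p,q}(\mathbf e)=\{x\in Z(\mathbf e):[h_1,x]=px,\ [h_2,x]=qx\}$. Index sets. $\mathcal E_{p,q}(\mathbf e)^{k}$ is the set of skew subdiagrams $C$ of $\Gamma^k$ such that $C+(p,q)$ is a $\sigma$-skew subdiagram of $\Gamma^k$. For $k\ne l$, $\mathcal E_{p,q}(\mathbf e)^{k,l}$ is the set of pairs $(C_1,C_2)$ with $C_1$ a skew subdiagram of $\Gamma^k$, $C_2$ a skew subdiagram of $\Gamma^l$ and $C_1+(p,q)=\sigma(C_2)$. $\mathcal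 E_{p,q}(\mathbf e)^{k,k}$ is the set of unordered $\{C_1,C_2\}$ of skew subdiagrams of $\Gamma^k$ with $C_1+(p,q)=\sigma(C_2)$ (which forces $p,q\in\mathbb Z$), where $C_1=C_2$ is allowed if $p+q$ is odd, while $C_1\neq C_2$ is required if $p+q$ is even. Finally $\mathcal E_{p,q}(\mathbf e)=\mathcal E_{p,q}(\mathbf e)^{1}$ in type A, and $\mathcal E_{p,q}(\mathbf e)$ is the disjoint union of the $\mathcal E_{p,q}(\mathbf e)^{k,l}$ with $k\le l$ in types B, C, D. *)

(* Defs.v *)
From mathcomp Require Import all_boot all_order all_algebra.
From mathcomp Require Import finmap boolp.

Set Implicit Arguments.
Unset Strict Implicit.
Unset Printing Implicit Defensive.

Import Order.TTheory GRing.Theory Num.Theory.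

Local Open Scope fset_scope.
Local Open Scope ring_scope.

(* Points of the plane have rational coordinates.  This loses no model pair:
   the operators h_1, h_2 have the coordinates of the points as eigenvalues in
   K, and these coordinates are half-integers in types B, C, D, and rational
   in type A, where the points lie in one coset of Z^2 and have sum 0. *)
Notation point := (rat * rat)%type.

Definition in_coset (x y : rat) (G : {fset point}) : Prop :=
  forall a : point, a \in G ->
    (a.1 - x \is a Num.int) /\ (a.2 - y \is a Num.int).

Definition diagram (G : {fset point}) : Prop := exists x y, in_coset x y G.

(* Euclidean distance 1. *)
Definition adjacent (a b : point) : bool :=
  (a.1 - b.1) ^+ 2 + (a.2 - b.2) ^+ 2 == 1.

Definition connected (G : {fset point}) : Prop :=
  forall a b : G, connect (relpre val adjacent) a b.

Definition skew_diagram (G : {fset point}) : Prop :=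
  [/\ G != fset0, diagram G, connected G &
      forall i j : rat, (i, j) \in G -> (i + 1, j + 1) \in G ->
        (i + 1, j) \in G /\ (i, j + 1) \in G].

Definition skew_diagram0 (G : {fset point}) : Prop :=
  G = fset0 \/ skew_diagram G.

Definition sigma (G : {fset point}) : {fset point} := [fset - a | a in G].

Definition translate (G : {fset point}) (p q : rat) : {fset point} :=
  [fset (a.1 + p, a.2 + q) | a in G].

Definition skew_subdiagram (G C : {fset point}) : Prop :=
  [/\ C `<=` G, skew_diagram C &
      forall i j : rat, (i, j) \in C ->
        (i - 1, j) \notin G `\` C /\ (i, j - 1) \notin G `\` C].

Definition sigma_skew_subdiagram (G C : {fset point}) : Prop :=
  skew_subdiagram (sigma G) (sigma C).

Definition centrally_symmetric (G : {fset point}) : Prop := sigma G = G.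

Definition integral (G : {fset point}) : Prop := in_coset 0 0 G.
Definition non_integral (G : {fset point}) : Prop := in_coset 2^-1 2^-1 G.

Inductive classical_type := typeA | typeB | typeC | typeD.

(* Gamma^1, Gamma^2, Gamma^3, indexed by k = 0, 1, 2. *)
Definition diagrams : Type := 3.-tuple {fset point}.

(* The values of the rank l for which sl_(l+1), so_(2l+1), sp_(2l) and so_(2l),
   respectively, are simple. *)
Definition simple_rank (t : classical_type) (l : nat) : bool :=
  match t with
  | typeA | typeB | typeC => (0 < l)%N
  | typeD => (2 < l)%N
  end.

Definition diagram_data (t : classical_type) (l : nat)
    (G1 G2 G3 : {fset point}) : Prop :=
  match t with
  | typeA =>
      [/\ skew_diagram G1, #|` G1| = l.+1,
          \sum_(a <- G1) a.1 = 0 /\ \sum_(a <- G1) a.2 = 0,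
          G2 = fset0 & G3 = fset0]
  | typeB =>
      [/\ [/\ skew_diagram0 G1, centrally_symmetric G1 & integral G1],
          [/\ skew_diagram0 G2, centrally_symmetric G2 & non_integral G2],
          (#|` G1| + #|` G2|)%N = (2 * l).+1 & G3 = fset0]
  | typeC =>
      [/\ [/\ skew_diagram0 G1, centrally_symmetric G1 & in_coset 0 2^-1 G1],
          [/\ skew_diagram0 G2, centrally_symmetric G2 & in_coset 2^-1 0 G2],
          (#|` G1| + #|` G2|)%N = (2 * l)%N & G3 = fset0]
  | typeD =>
      [/\ [/\ skew_diagram0 G1, centrally_symmetric G1 & non_integral G1],
          skew_diagram0 G2 /\ centrally_symmetric G2,
          skew_diagram0 G3 /\ centrally_symmetric G3,
          (#|` G1| + #|` G2| + #|` G3|)%N = (2 * l)%N &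
          (G2 = fset0 /\ G3 = fset0) \/
          [/\ G2 <> fset0 /\ G3 <> fset0, integral G2 /\ integral G3,
              G2 `&` G3 = [fset ((0, 0) : point)] &
              G3 <> [fset ((0, 0) : point)]]]
  end.

(* The index set of the basis (v^k_(i,j)) of V. *)
Definition label (G : diagrams) : finType := {k : 'I_3 & tnth G k}.

Definition dimV (G : diagrams) : nat := #|label G|.

Definition lab (G : diagrams) (a : 'I_(dimV G)) : 'I_3 * point :=
  (tag (enum_val a), val (tagged (enum_val a))).

Section Model.

Variables (K : closedFieldType) (t : classical_type) (G : diagrams).

Let n := dimV G.

(* V is identified with 'cV[K]_n; v k i j = 0 when (i, j) is not in Gamma^k. *)
Definition v (k : 'I_3) (i j : rat) : 'cV[K]_n :=
  \col_a (lab a == (k, (i, j)))%:R.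

(* The endomorphism mapping v^k_(i,j) to f k i j for all (i, j) in Gamma^k. *)
Definition operator (f : 'I_3 -> rat -> rat -> 'cV[K]_n) : 'M[K]_n :=
  \matrix_(a, b) f (lab b).1 (lab b).2.1 (lab b).2.2 a 0.

(* (-1)^r, used only when r is an integer. *)
Definition sgnpow (r : rat) : K := (-1) ^ (Num.floor r).

Definition h1 : 'M[K]_n := operator (fun k i j => ratr i *: v k i j).
Definition h2 : 'M[K]_n := operator (fun k i j => ratr j *: v k i j).

Definition e1 : 'M[K]_n :=
  match t with
  | typeA | typeC => operator (fun k i j => v k (i + 1) j)
  | typeB | typeD => operator (fun k i j => sgnpow (i + j) *: v k (i + 1) j)
  end.

Definition e2 : 'M[K]_n :=
  match t with
  | typeA | typeC => operator (fun k i j => v k i (j + 1))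
  | typeB | typeD =>
      operator (fun k i j => sgnpow (i + j + 1) *: v k i (j + 1))
  end.

(* Gram matrix of the form on V in types B, C, D (unused in type A). *)
Definition gram : 'M[K]_n :=
  \matrix_(a, b)
    let: (k, (i, j)) := lab a in let: (m, (i', j')) := lab b in
    (if t is typeC then sgnpow (i + j + 2^-1) else 1) *
    (i == - i')%:R * (j == - j')%:R * (k == m)%:R.

(* sl(V) in type A, and the Lie algebra of the form gram in types B, C, D. *)
Definition in_g (x : 'M[K]_n) : bool :=
  match t with
  | typeA => \tr x == 0
  | _ => x^T *m gram + gram *m x == 0
  end.

Definition lie (x y : 'M[K]_n) : 'M[K]_n := x *m y - y *m x.

Definition Z : {pred 'M[K]_n} :=
  [pred x | [&& in_g x, lie x e1 == 0 & lie x e2 == 0]].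

Definition Zpq (p q : rat) : {pred 'M[K]_n} :=
  [pred x | [&& x \in Z, lie h1 x == ratr p *: x & lie h2 x == ratr q *: x]].

End Model.

Arguments Zpq : clear implicits.

Section IndexSets.

Variables (G : diagrams) (p q : rat).

Definition skew_subdiagrams (D : {fset point}) : {fset {fset point}} :=
  [fset C in fpowerset D | `[< skew_subdiagram D C >]].

Definition E_single (k : 'I_3) : {fset {fset point}} :=
  [fset C in skew_subdiagrams (tnth G k) |
    `[< sigma_skew_subdiagram (tnth G k) (translate C p q) >]].

Definition E_pairs (k l : 'I_3) : {fset {fset point} * {fset point}} :=
  [fset C in skew_subdiagrams (tnth G k) `*` skew_subdiagrams (tnth G l) |
    translate C.1 p q == sigma C.2].

Definition odd_integer (r : rat) : bool :=
  (r \is a Num.int) && odd `|Num.floor r|%N.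

(* An unordered pair {C1, C2} is the finite set [fset C1; C2], which is a
   singleton when C1 = C2. *)
Definition E_unordered (k : 'I_3) : {fset {fset {fset point}}} :=
  [fset [fset C1; C2] | C1 in skew_subdiagrams (tnth G k),
                        C2 in skew_subdiagrams (tnth G k) &
                        (translate C1 p q == sigma C2) &&
                        ((C1 == C2) ==> odd_integer (p + q))].

Definition E (t : classical_type) : finType :=
  match t with
  | typeA => E_single ord0
  | _ => ({k : 'I_3 & E_unordered k} +
          {kl : {kl : 'I_3 * 'I_3 | (kl.1 < kl.2)%N} &
             E_pairs (val kl).1 (val kl).2})%type
  end.

End IndexSets.

(* Main.v *)
(* Once the signs in e_1, e_2 are divided out, a linear map of degree d from the
   span of a skew diagram X to that of Y commutes with e_1 and e_2 exactly when
   its scalars on X :&: (Y - d) are constant along adjacent points and vanish at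
   the points where one of e_1, e_2 leaves this intersection on one side only.
   It is thus a combination of indicators of the connected components C of
   X :&: (Y - d) that are closed downwards in X and, shifted by d, upwards in Y:
   these are the C such that C is a skew subdiagram of X and C + d a sigma-skew
   subdiagram of Y.  In types B, C and D the form adds a condition on the
   scalars under a |-> - a - d, which sends the block (k, l, C) to
   (l, k, - C - d), with sign - (-1)^(p+q); hence a component with
   C = - C - d contributes only when p + q is odd. *)
Require Import Defs.
From mathcomp Require Import all_boot all_order all_algebra.
From mathcomp Require Import finmap boolp.
From mathcomp Require Import zify ring.

Set Implicit Arguments.
Unset Strict Implicit.
Unset Printing Implicit Defensive.

Import Order.TTheory GRing.Theory Num.Theory.
Local Open Scope fset_scope.
Local Open Scope ring_scope.

(** * Unit steps, adjacency and skew subdiagrams *)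

Definition step (b : bool) : point := if b then (1, 0) else (0, 1).

(** Connectedness as an induction principle: whatever spreads along adjacent points spreads over the
    whole set. Later arguments use this form in place of explicit paths. *)
Lemma connectedP (C : {fset point}) :
  connected C <-> forall (P : point -> Prop) a, a \in C -> P a ->
    (forall x y, x \in C -> y \in C -> adjacent x y -> P x -> P y) ->
    forall b, b \in C -> P b.
Proof.
split=> [Cc P a aC Pa Pst b bC|H a b].
  have /connectP[s sP sE] := Cc [` aC] [` bC].
  suff: P (val (last [` aC] s)) by rewrite -sE.
  elim: s [` aC] (Pa : P (val [` aC])) sP {sE} => //= y s IH x Px /andP[xy sP].
  by apply: IH => //; apply: Pst xy Px; apply: fsvalP.
(* Reachability from [a], packed with a membership proof because [connect] lives on the subtype of
   points of [C]. *)
pose P x := exists hx : x \in C, connect (relpre val adjacent) a [` hx].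
have [hb ab] : P (val b).
  apply: (H P (val a)); rewrite ?fsvalP //.
    exists (fsvalP a); suff -> : [` fsvalP a] = a by [].
    exact: val_inj.
  move=> x y xC yC xy [hx ax]; exists yC; apply: connect_trans ax _.
  exact: connect1.
by suff -> : b = [` hb] by []; apply: val_inj.
Qed.

Lemma adjacent_sym (a b : point) : adjacent a b = adjacent b a.
Proof. by rewrite /adjacent -sqrrN opprB -(sqrrN (a.2 - _)) opprB. Qed.

Lemma adjacent_step (a : point) b : adjacent a (a + step b).
Proof. by case: a b => i j [] /=; rewrite /adjacent /=; apply/eqP; ring. Qed.

(** In a common coset the coordinate differences are integers [m], [n] with [m^2 + n^2 = 1], so one
    is 0 and the other is 1 or -1. For arbitrary rational points this fails: the vector (3/5, 4/5)
    has length 1. *)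
Lemma adjacentP (x y : rat) (X : {fset point}) (a b : point) :
    in_coset x y X -> a \in X -> b \in X -> adjacent a b ->
  exists c, b = a + step c \/ a = b + step c.
Proof.
move=> cX /cX[a1 a2] /cX[b1 b2] /eqP.
have /intrP[m mE] : a.1 - b.1 \is a Num.int.
  by rewrite (_ : _ - _ = (a.1 - x) - (b.1 - x)); [apply: rpredB|ring].
have /intrP[n nE] : a.2 - b.2 \is a Num.int.
  by rewrite (_ : _ - _ = (a.2 - y) - (b.2 - y)); [apply: rpredB|ring].
rewrite mE nE -!rmorphXn -rmorphD -[1]/(1%:~R) => /intr_inj mn.
have {}mn : (m = 0 /\ (n = 1 \/ n = -1)) \/ (n = 0 /\ (m = 1 \/ m = -1)).
  by move: mn; rewrite !expr2; nia.
have aE : a = b + (m%:~R, n%:~R).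
  by rewrite -mE -nE; case: a b {a1 a2 b1 b2 mE nE} => [i j] [i' j'] /=;
     congr (_, _) => /=; ring.
have bE : b = a + (- m%:~R, - n%:~R).
  by rewrite aE; case: (b) => i j; congr (_, _) => /=; ring.
case: mn => -[m0 [n1|n1]].
- by exists false; right; rewrite aE m0 n1.
- by exists false; left; rewrite bE m0 n1 oppr0 opprK.
- by exists true; right; rewrite aE m0 n1.
- by exists true; left; rewrite bE m0 n1 oppr0 opprK.
Qed.

Lemma skew0_coset X : skew_diagram0 X -> diagram X.
Proof. by case=> [-> | []//]; exists 0, 0 => a; rewrite in_fset0. Qed.

Lemma add_step (a : point) b :
  a + step b = if b then (a.1 + 1, a.2) else (a.1, a.2 + 1).
Proof. by case: a b => i j [] /=; congr (_, _); rewrite /= addr0. Qed.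

Lemma sub_step i j b :
  (i, j) - step b = if b then (i - 1, j) else (i, j - 1) :> point.
Proof. by case: b; congr (_, _); rewrite /= subr0. Qed.

(** The square condition on [C] comes for free: the two missing corners lie in [X] because [X] is
    skew, and downward closure from the upper corner [(i + 1, j + 1)] puts them in [C]. *)
Lemma skew_subdiagramP (X C : {fset point}) : skew_diagram0 X ->
  skew_subdiagram X C <->
  [/\ C `<=` X, C != fset0, connected C &
      forall a b, a \in C -> a - step b \in X -> a - step b \in C].
Proof.
move=> sX; split=> [[CX [C0 _ Cc _] H]|[CX C0 Cc H]].
  split=> // -[i j] b /H[h1 h2]; rewrite sub_step.
  by case: b; [move: h1|move: h2]; rewrite in_fsetD negb_and negbK;
     case/orP=> // /negPf->.
have {}H i j : (i, j) \in C ->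
    (i - 1, j) \notin X `\` C /\ (i, j - 1) \notin X `\` C.
  move=> ijC; have := H _ true ijC; have := H _ false ijC; rewrite !sub_step.
  by rewrite !in_fsetD !negb_and !negbK => h1 h2; split;
     rewrite orbC -implybE; apply/implyP.
split=> //; split=> //.
  have [x [y cX]] := skew0_coset sX; exists x, y => a aC.
  by apply: cX; apply: (fsubsetP CX).
move=> i j aC bC; have [h1 h2] := H _ _ bC.
have [k1 k2] : (i + 1, j) \in X /\ (i, j + 1) \in X.
  have [aX bX] := (fsubsetP CX _ aC, fsubsetP CX _ bC).
  by case: sX aX bX => [-> //|[_ _ _]]; apply.
by move: h1 h2; rewrite !addrK !in_fsetD k1 k2 !andbT !negbK.
Qed.

(** * Intertwiners between the spans of two skew diagrams *)

Lemma in_sigma (X : {fset point}) a : (a \in sigma X) = (- a \in X).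
Proof.
apply/imfsetP/idP => [[b /= bX ->]|aX]; first by rewrite opprK.
by exists (- a); rewrite ?opprK.
Qed.

Lemma in_translate (X : {fset point}) (d a : point) :
  (a \in translate X d.1 d.2) = (a - d \in X).
Proof.
apply/imfsetP/idP => [[b /= bX ->]|aX].
  by rewrite (_ : (_, _) = b + d) // addrK.
by exists (a - d) => //; rewrite -[LHS](subrK d).
Qed.

Lemma sigmaK X : sigma (sigma X) = X.
Proof. by apply/fsetP => a; rewrite !in_sigma opprK. Qed.

Lemma adjacentN (a b : point) : adjacent (- a) (- b) = adjacent a b.
Proof. by rewrite /adjacent /= -!opprD !sqrrN. Qed.

Lemma adjacentD (d a b : point) : adjacent (a + d) (b + d) = adjacent a b.
Proof.
have E1 : (a + d).1 - (b + d).1 = a.1 - b.1 by rewrite /=; ring.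
have E2 : (a + d).2 - (b + d).2 = a.2 - b.2 by rewrite /=; ring.
by rewrite /adjacent E1 E2.
Qed.

Lemma connected_sigma X : connected X -> connected (sigma X).
Proof.
move=> /connectedP cX; apply/connectedP => P a.
rewrite in_sigma => aX Pa H b bX.
have := cX (fun x => P (- x)) (- a) aX; rewrite opprK; move=> /(_ Pa).
move=> K; rewrite -[b]opprK; apply: K; last by rewrite -in_sigma.
by move=> x y xX yX xy; apply: H; rewrite ?in_sigma ?opprK ?adjacentN.
Qed.

Lemma connected_translate X (d : point) :
  connected X -> connected (translate X d.1 d.2).
Proof.
move=> /connectedP cX; apply/connectedP => P a.
rewrite in_translate => aX Pa H b bX.
have := cX (fun x => P (x + d)) (a - d) aX; rewrite subrK; move=> /(_ Pa).
move=> K; rewrite -[b](subrK d); apply: K; last by rewrite -in_translate.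
by move=> x y xX yX xy; apply: H; rewrite ?in_translate ?addrK ?adjacentD.
Qed.

Lemma skew0_sigma X : skew_diagram0 X -> skew_diagram0 (sigma X).
Proof.
case=> [->|[/fset0Pn[a aX] [x [y cX]] conX sqX]]; [left|right; split].
- by apply/fsetP => a; rewrite in_sigma !in_fset0.
- by apply/fset0Pn; exists (- a); rewrite in_sigma opprK.
- exists (- x), (- y) => b; rewrite in_sigma => /cX[h1 h2].
  by split; rewrite -rpredN opprD opprK.
- exact: connected_sigma.
move=> i j; rewrite !in_sigma => h1 h2.
have := sqX (- (i + 1)) (- (j + 1)) h2.
by rewrite !opprD !subrK => /(_ h1)[]; rewrite -!opprD; split.
Qed.

(* [C] indexes an intertwiner of degree [d] between the spans of [X] and [Y]. *)
Definition good (X Y : {fset point}) (d : point) (C : {fset point}) : Prop :=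
  skew_subdiagram X C /\ sigma_skew_subdiagram Y (translate C d.1 d.2).

(** Since [sigma] reverses steps, downward closure of the reflected set in [sigma Y] becomes upward
    closure of the translate of [C] in [Y]. *)
Lemma goodP X Y d C : skew_diagram0 X -> skew_diagram0 Y ->
  good X Y d C <->
  [/\ C != fset0, connected C,
      forall a, a \in C -> a \in X /\ a + d \in Y,
      forall a b, a \in C -> a - step b \in X -> a - step b \in C &
      forall a b, a \in C -> a + step b + d \in Y -> a + step b \in C].
Proof.
move=> sX sY; rewrite /good /sigma_skew_subdiagram skew_subdiagramP //.
rewrite skew_subdiagramP; last exact: skew0_sigma.
split=> [[[CX C0 Cc CXl] [CY _ _ CYu]]|[C0 Cc CXY CXl CYu]].
  split=> // [a aC|a b aC abY]; first split; first exact: (fsubsetP CX).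
    have := fsubsetP CY (- (a + d)).
    by rewrite !in_sigma opprK in_translate addrK; apply.
  have := CYu (- (a + d)) b.
  have E : - (- (a + d) - step b) = a + step b + d.
    by rewrite opprB opprK addrC addrAC.
  rewrite !in_sigma !in_translate E !addrK opprK addrK.
  exact.
split; split => //.
- by apply/fsubsetP => a /CXY[].
- by apply/fsubsetP => a; rewrite !in_sigma in_translate => /CXY[_]; rewrite subrK.
- have [a aC] := fset0Pn _ C0.
  by apply/fset0Pn; exists (- (a + d)); rewrite in_sigma opprK in_translate addrK.
- by apply: connected_sigma; apply: connected_translate.
move=> a b; rewrite !in_sigma !in_translate.
have -> : - (a - step b) = - a - d + step b + d by rewrite opprB addrAC subrK addrC.
by rewrite addrK; apply: CYu.
Qed.

Definition flip (d : point) (C : {fset point}) := sigma (translate C d.1 d.2).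

Lemma in_flip d C a : (a \in flip d C) = (- a - d \in C).
Proof. by rewrite in_sigma in_translate. Qed.

Lemma flipK d : involutive (flip d).
Proof.
by move=> C; apply/fsetP => a; rewrite !in_flip opprB addrAC subrr add0r opprK.
Qed.

(** For symmetric diagrams the two halves of [good] say that [C] is a skew subdiagram of [X] and
    [flip d C] one of [Y]; the involution [flip d] exchanges them. *)
Lemma good_flip X Y d C : centrally_symmetric X -> centrally_symmetric Y ->
  good X Y d C -> good Y X d (flip d C).
Proof.
rewrite /good /sigma_skew_subdiagram -/(flip d C) -/(flip d (flip d C)).
by rewrite flipK => -> -> [].
Qed.

(** The second member of a pair in the index set is determined by the first, which turns pairs into
    single good sets. *)
Lemma opposite_pairP X Y d C C' : centrally_symmetric Y ->
  (skew_subdiagram X C /\ skew_subdiagram Y C' /\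
   translate C d.1 d.2 = sigma C') <-> good X Y d C /\ C' = flip d C.
Proof.
move=> sY; rewrite /good /sigma_skew_subdiagram -/(flip d C) sY.
split=> [[h1 [h2 h3]]|[[h1 h2] ->]]; last by rewrite sigmaK.
by rewrite /flip h3 sigmaK.
Qed.

(** * Good sets as components, and their indicators *)

Section Blocks.

Variables (R : nzRingType) (X Y : {fset point}) (d : point).
Hypotheses (sX : skew_diagram0 X) (sY : skew_diagram0 Y).

(** A step up is absorbed by closure in [Y], a step down by closure in [X]. A good set is therefore
    a whole connected component of the intersection of [X] with [Y - d], and two good sets that meet
    are equal. *)
Lemma good_absorb C a b : good X Y d C -> a \in C -> b \in X -> b + d \in Y ->
  adjacent a b -> b \in C.
Proof.
move=> /(goodP _ _ sX sY)[_ _ CXY CXl CYu] aC bX bY ab.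
have [x [y cX]] := skew0_coset sX.
have [c [bE|aE]] := adjacentP cX (CXY _ aC).1 bX ab.
  by rewrite bE in bY *; apply: CYu.
by have := CXl a c aC; rewrite aE addrK; apply.
Qed.

Lemma good_sub C C' a : good X Y d C -> good X Y d C' -> a \in C -> a \in C' ->
  C `<=` C'.
Proof.
move=> /(goodP _ _ sX sY)[_ /connectedP cC CXY _ _] gC' aC aC'.
apply/fsubsetP => b bC.
apply: (cC (fun x => x \in C') a aC aC') bC => x y xC yC xy xC'.
by have [yX yY] := CXY _ yC; apply: (good_absorb gC' xC').
Qed.

Lemma good_eq C C' a : good X Y d C -> good X Y d C' -> a \in C -> a \in C' ->
  C = C'.
Proof.
move=> gC gC' aC aC'; apply/eqP; rewrite eqEfsubset.
by rewrite (good_sub gC gC' aC aC') (good_sub gC' gC aC' aC).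
Qed.

(* The scalars of an intertwiner of degree [d] from the span of [X] to that of
   [Y]: it sends [v_a] to [f a] times [v_(a + d)]. *)
Definition intertwiner (f : point -> R) : Prop :=
  (forall a, f a != 0 -> a \in X /\ a + d \in Y) /\
  (forall a b, a \in X -> a + step b + d \in Y -> f (a + step b) = f a).

Lemma intertwiner_const f C : intertwiner f -> good X Y d C ->
  {in C &, forall a b, f a = f b}.
Proof.
move=> [_ fS] gC a b aC bC; have /(goodP _ _ sX sY)[_ cC CXY _ _] := gC.
move/connectedP: cC => /(_ (fun x => f a = f x) a aC erefl); apply => //.
move=> x y xC yC xy ->; have [x0 [y0 cX]] := skew0_coset sX.
have [[xX xY] [yX yY]] := (CXY _ xC, CXY _ yC).
have [c [yE|xE]] := adjacentP cX xX yX xy.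
  by rewrite yE fS // -yE.
by rewrite xE fS // -xE.
Qed.

(** The two directions of the step equation are the two closure properties: downward closure in [X]
    and upward closure in [Y]. *)
Lemma intertwiner_indicator C : good X Y d C ->
  intertwiner (fun a => (a \in C)%:R).
Proof.
move=> gC; have /(goodP _ _ sX sY)[_ cC CXY CXl CYu] := gC.
split=> [a|a b aX aY].
  by apply: contra_neqP => aXY; case: (boolP (a \in C)) => // /CXY.
congr (_%:R); congr nat_of_bool; apply/idP/idP => [|aC]; last exact: CYu.
by move=> /(CXl _ b); rewrite addrK; apply.
Qed.

(** Take the component of [a] in the intersection of [X] with [Y - d]. There [f] stays nonzero, and
    the step equation carries nonvanishing to any neighbour below in [X] or above in [Y - d]; such a
    neighbour is in the support, hence in the component. *)
Lemma intertwiner_support f a : intertwiner f -> f a != 0 ->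
  exists2 C, good X Y d C & a \in C.
Proof.
move=> [fS fE] fa.
(* The component is defined impredicatively: [b] belongs to it when every property of [a] closed
   under adjacency in the intersection holds at [b]. *)
pose closed_in (P : point -> Prop) := forall x y, x \in X -> y \in X ->
  x + d \in Y -> y + d \in Y -> adjacent x y -> P x -> P y.
pose C := [fset b in X | (b + d \in Y) &&
             `[< forall P, closed_in P -> P a -> P b >]].
have inC b : b \in C -> [/\ b \in X, b + d \in Y &
    forall P, closed_in P -> P a -> P b].
  by rewrite !inE => /and3P[? ? /asboolP ?]; split.
have Cin x y : x \in C -> y \in X -> y + d \in Y -> adjacent x y -> y \in C.
  move=> /inC[xX xY xP] yX yY xy; rewrite !inE yX yY /=; apply/asboolP => P cP Pa.
  by apply: (cP x y) => //; apply: xP.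
have fC x : x \in C -> f x != 0.
  move=> /inC[_ _ /(_ (fun x => f x != 0))]; apply=> // {}x y xX yX xY yY xy.
  have [x0 [y0 cX]] := skew0_coset sX.
  have [c [yE|xE]] := adjacentP cX xX yX xy.
    by rewrite yE fE // -yE.
  by rewrite xE fE // -xE.
have aC : a \in C.
  by have [aX aY] := fS _ fa; rewrite !inE aX aY /=; apply/asboolP.
exists C => //; apply/goodP => //; split.
- by apply/fset0Pn; exists a.
- apply/connectedP => P.
  (* Induction from [a] that stays inside [C], obtained by strengthening [Q] with membership in
     [C]. *)
  have W (Q : point -> Prop) : Q a -> (forall x y, x \in C -> y \in C ->
      adjacent x y -> Q x -> Q y) -> forall b, b \in C -> Q b.
    move=> Qa cQ b bC; have [_ _ /(_ (fun x => x \in C /\ Q x))] := inC _ bC.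
    case=> // x y xX yX xY yY xy [xC Qx].
    by have yC := Cin _ _ xC yX yY xy; split=> //; apply: (cQ x).
  move=> x xC Px cP b; apply: (W) => //.
  (* [C] is connected to its base point, hence to each of its points. *)
  suff: P x -> P a by apply.
  apply: (W (fun x => P x -> P a)) xC => // y z yC zC yz Py Pz.
  by apply: Py; apply: (cP z) => //; rewrite adjacent_sym.
- by move=> b /inC[].
- move=> b c bC bX; have [_ bY _] := inC _ bC.
  have fb : f (b - step c) != 0 by rewrite -(fE _ c) ?subrK ?fC.
  have [_ bY'] := fS _ fb; apply: Cin bC bX bY' _.
  by rewrite adjacent_sym -{2}[b](subrK (step c)) adjacent_step.
move=> b c bC bY; have [bX _ _] := inC _ bC.
have fb : f (b + step c) != 0 by rewrite fE ?fC.
by have [bX' _] := fS _ fb; apply: Cin bC bX' bY _; rewrite adjacent_step.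
Qed.

End Blocks.

(** * Entries, characteristic zero and signs *)

(** The entries at positions [r i] act as a dual family, up to nonzero scalars. Reading them off
    gives freeness; subtracting from [x] the combination with the same entries leaves an element of
    [U] with no nonzero entry at these positions, hence 0. *)
Lemma basis_of_entries (F : fieldType) m (I : finType) (U : {pred 'M[F]_m})
    (b : I -> 'M[F]_m) (r : I -> 'I_m * 'I_m) :
  0 \in U -> (forall c x y, x \in U -> y \in U -> c *: x + y \in U) ->
  (forall i, b i \in U) ->
  (forall i j, (b i (r j).1 (r j).2 != 0) = (i == j)) ->
  (forall x, x \in U -> x != 0 -> exists i, x (r i).1 (r i).2 != 0) ->
  free (codom b) /\ <<codom b>>%VS =i U.
Proof.
move=> U0 Ulin bU bdiag Usep.
have bi i : b i (r i).1 (r i).2 != 0 by rewrite bdiag.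
have entry (k : I -> F) j : (\sum_i k i *: b i) (r j).1 (r j).2 =
    k j * b j (r j).1 (r j).2.
  rewrite summxE (bigD1 j) //= mxE big1 ?addr0 // => i ij; rewrite mxE.
  by move: (bdiag i j); rewrite (negPf ij) => /negbFE/eqP->; rewrite mulr0.
have Usum (k : I -> F) : \sum_i k i *: b i \in U.
  by elim/big_rec: _ => // i x _; apply: Ulin.
have codomE (k : 'I_#|I| -> F) :
    \sum_i k i *: (codom_tuple b)`_i = \sum_i k (enum_rank i) *: b i.
  rewrite (reindex (@enum_rank I)) /=; last exact/onW_bij/enum_rank_bij.
  apply: eq_bigr => i _; congr (_ *: _).
  by rewrite codomE (nth_map i) ?nth_enum_rank // -cardE ltn_ord.
split.
  apply/(@freeP _ _ _ (codom_tuple b)) => k; rewrite codomE => k0 i.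
  have := entry (k \o enum_rank) (enum_val i).
  rewrite k0 mxE /= enum_valK => /esym/eqP.
  by rewrite mulf_eq0 (negPf (bi _)) orbF => /eqP.
move=> x; apply/idP/idP => [xb|xU].
  by rewrite (@coord_span _ _ _ (codom_tuple b) x xb) codomE.
pose k i := x (r i).1 (r i).2 / b i (r i).1 (r i).2.
have : x - \sum_i k i *: b i == 0.
  apply: contraT => /Usep[|i]; first by rewrite addrC -scaleN1r Ulin.
  by rewrite mxE [X in _ + X]mxE entry /k divfK ?subrr ?eqxx.
rewrite subr_eq0 => /eqP ->; apply: memv_suml => i _.
by apply/memvZ/memv_span/codom_f.
Qed.

Section CharZero.

Variables (F : fieldType) (charF : [pchar F] =i pred0).

Lemma intr_eq0_char0 (m : int) : ((m%:~R : F) == 0) = (m == 0).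
Proof.
have H n : ((n%:R : F) == 0) = (n == 0)%N by move: n; apply/pcharf0P.
by case: m => n; rewrite ?NegzE ?mulrNz ?oppr_eq0 -?pmulrn H ?eqz_nat.
Qed.

(** Denominators stay nonzero in characteristic 0, so clearing them turns both sides into the same
    integer equation. This translates eigenvalues in [K] into rational coordinates. *)
Lemma ratr_sub_eq (x y z : rat) :
  (ratr x - ratr y == ratr z :> F) = (x - y == z).
Proof.
have dF (a : rat) : (denq a)%:~R != 0 :> F.
  by rewrite intr_eq0_char0 denq_neq0.
have dQ (a : rat) : (denq a)%:~R != 0 :> rat by rewrite intr_eq0 denq_neq0.
have cross (L : fieldType) (a b c a' b' c' : L) : a' != 0 -> b' != 0 -> c' != 0 ->
    (a / a' - b / b' == c / c') = (a * b' * c' - b * a' * c' - c * a' * b' == 0).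
  move=> a0 b0 c0; rewrite -subr_eq0.
  have -> : a / a' - b / b' - c / c' =
     (a * b' * c' - b * a' * c' - c * a' * b') / (a' * b' * c').
    by field; rewrite a0 b0 c0.
  by rewrite mulf_eq0 invr_eq0 !mulf_eq0 (negPf a0) (negPf b0) (negPf c0) !orbF.
rewrite -{2}[x]divq_num_den -{2}[y]divq_num_den -{2}[z]divq_num_den /ratr.
by rewrite !cross // -!rmorphM -!rmorphB /= intr_eq0_char0 intr_eq0.
Qed.

End CharZero.

Lemma odd_integerD a b : a \is a Num.int -> b \is a Num.int ->
  odd_integer (a + b) = odd_integer a (+) odd_integer b.
Proof.
move=> aZ bZ; rewrite /odd_integer rpredD // aZ bZ /=.
by rewrite floorDzr //; move: (Num.floor a) (Num.floor b) => m n; lia.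
Qed.

Lemma odd_integerN a : odd_integer (- a) = odd_integer a.
Proof.
rewrite /odd_integer rpredN; case: (boolP (a \is a Num.int)) => //= /intrP[m ->].
by rewrite -rmorphN /= !intrKfloor abszN.
Qed.

Lemma sgnpowE (K : closedFieldType) a : a \is a Num.int ->
  sgnpow K a = (-1) ^+ odd_integer a.
Proof.
move=> aZ; rewrite /sgnpow /odd_integer aZ /= signr_odd.
by case: (Num.floor a) => n //; rewrite NegzE -exprnN /= -exprVn invrN1.
Qed.

(** * The centralizer in terms of scalars *)

Section Labels.

Variable G : diagrams.

Lemma lab_inj : injective (@lab G).
Proof.
move=> a b; rewrite /lab => -[].
move: (enum_val a) (enum_val b) (@enum_val_inj _ _ a b).
case=> k x [k' x'] /= inj kk'; subst k' => xx'; apply: inj.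
by congr (Tagged _ _); apply: val_inj.
Qed.

Lemma lab_mem (a : 'I_(dimV G)) : (lab a).2 \in tnth G (lab a).1.
Proof. exact: fsvalP. Qed.

Lemma lab_surj k x : x \in tnth G k -> exists a : 'I_(dimV G), lab a = (k, x).
Proof.
move=> xG; exists (enum_rank (Tagged (fun k => tnth G k) [` xG] : label G)).
by rewrite /lab enum_rankK.
Qed.

Variable K : pzRingType.

Lemma sum_lab (F : 'I_(dimV G) -> K) a :
  \sum_u F u * (lab u == lab a)%:R = F a.
Proof.
rewrite (bigD1 a) //= eqxx mulr1 big1 ?addr0 // => u ua.
by rewrite (inj_eq lab_inj) (negPf ua) mulr0.
Qed.

Lemma sum_lab0 (F : 'I_(dimV G) -> K) k x : x \notin tnth G k ->
  \sum_u F u * (lab u == (k, x))%:R = 0.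
Proof.
move=> xG; apply: big1 => u _; case: eqP => [E|]; last by rewrite mulr0.
by have := lab_mem u; rewrite E /= (negPf xG).
Qed.

End Labels.

Definition alternating_signs t := if t is (typeB | typeD) then true else false.

Definition height (a : point) : rat := a.1 + a.2.

(** * Homogeneous maps, commutators and signs *)

Section Degree.

Variables (K : closedFieldType) (charK : [pchar K] =i pred0).
Variables (t : classical_type) (G : diagrams) (d : point).

(* In types B and D the scalars of an intertwiner are not constant on adjacent
   points, but become so after division by this sign. *)
Definition gauge (a : point) : K :=
  (-1) ^+ [&& alternating_signs t, odd_integer (height d) & odd_integer (height a)].

Lemma gaugeK a : gauge a * gauge a = 1.
Proof. by rewrite -expr2 sqrr_sign. Qed.

(** Columns are sources and rows are targets: [v^k_a] goes to the sum over [l] of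
    [gauge a * f k l a] times [v^l_(a + d)]. *)
Definition model_mx (f : 'I_3 -> 'I_3 -> point -> K) : 'M[K]_(dimV G) :=
  \matrix_(y, z) (((lab y).2 == (lab z).2 + d)%:R *
    (gauge (lab z).2 * f (lab z).1 (lab y).1 (lab z).2)).

Definition supported (f : 'I_3 -> 'I_3 -> point -> K) :=
  forall k l a, f k l a != 0 -> a \in tnth G k /\ a + d \in tnth G l.

Lemma sum_model_r f y k a : supported f ->
  \sum_u model_mx f y u * (lab u == (k, a))%:R =
  ((lab y).2 == a + d)%:R * (gauge a * f k (lab y).1 a).
Proof.
move=> sf; case: (boolP (a \in tnth G k)) => aG.
  by have [u uE] := lab_surj aG; rewrite -uE sum_lab mxE uE.
rewrite sum_lab0 //; case: (eqVneq (f k (lab y).1 a) 0) => [->|/sf[aG' _]].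
  by rewrite !mulr0.
by rewrite aG' in aG.
Qed.

Lemma sum_model_l f z k a : supported f ->
  \sum_u model_mx f u z * (lab u == (k, a))%:R =
  (a == (lab z).2 + d)%:R * (gauge (lab z).2 * f (lab z).1 k (lab z).2).
Proof.
move=> sf; case: (boolP (a \in tnth G k)) => aG.
  by have [u uE] := lab_surj aG; rewrite -uE sum_lab mxE uE.
rewrite sum_lab0 //; case: eqVneq => [E|]; last by rewrite mul0r.
case: (eqVneq (f (lab z).1 k (lab z).2) 0) => [->|/sf[_]].
  by rewrite !mulr0.
by rewrite -E (negPf aG).
Qed.

(** Weighted translation by [e], a common shape for [h1], [h2], [e1] and [e2]. *)
Definition shift (s : point -> K) (e : point) : 'M[K]_(dimV G) :=
  \matrix_(a, b) (s (lab b).2 * (lab a == ((lab b).1, (lab b).2 + e))%:R).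

(** The term [(~~ b)%:R] is the extra 1 in the exponent of the sign of [e2]. *)
Definition step_sign (b : bool) (a : point) : K :=
  if alternating_signs t then sgnpow K (height a + (~~ b)%:R) else 1.

Lemma h1E : h1 K G = shift (fun a => ratr a.1) 0.
Proof.
apply/matrixP => a b; rewrite !mxE addr0; congr (_ * (_ == _)%:R).
by case: (lab b) => k [].
Qed.

Lemma h2E : h2 K G = shift (fun a => ratr a.2) 0.
Proof.
apply/matrixP => a b; rewrite !mxE addr0; congr (_ * (_ == _)%:R).
by case: (lab b) => k [].
Qed.

Lemma e1E : e1 K t G = shift (step_sign true) (step true).
Proof.
apply/matrixP => a b; rewrite [RHS]mxE add_step /e1 /step_sign /height addr0.
by case: t; rewrite !mxE /= ?mul1r.
Qed.

Lemma e2E : e2 K t G = shift (step_sign false) (step false).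
Proof.
apply/matrixP => a b; rewrite [RHS]mxE add_step /e2 /step_sign /height.
by case: t; rewrite !mxE /= ?mul1r.
Qed.

Lemma lieE (x y : 'M[K]_(dimV G)) a b :
  lie x y a b = \sum_u x a u * y u b - \sum_u y a u * x u b.
Proof. by rewrite !mxE. Qed.

Lemma lie_diag s x y z :
  lie (shift s 0) x y z = (s (lab y).2 - s (lab z).2) * x y z.
Proof.
have dE a b : shift s 0 a b = s (lab b).2 * (lab a == lab b)%:R.
  by rewrite mxE addr0; case: (lab b).
rewrite lieE mulrBl; congr (_ - _).
  under eq_bigr => u _ do rewrite dE eq_sym mulrAC.
  by rewrite (sum_lab (fun u => s (lab u).2 * x u z)).
under eq_bigr => u _ do rewrite dE mulrCA.
by rewrite -mulr_sumr sum_lab.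
Qed.

(** Bracketing with a diagonal matrix multiplies each entry by a difference of eigenvalues. *)
Lemma lie_diag_eq (s : point -> rat) (c : rat) (x : 'M[K]_(dimV G)) :
  lie (shift (fun a => ratr (s a)) 0) x = ratr c *: x <->
  forall y z, x y z != 0 -> s (lab y).2 - s (lab z).2 = c.
Proof.
split=> [/matrixP xE y z xyz|xE].
  have /eqP := xE y z; rewrite lie_diag mxE (inj_eq (mulIf xyz)).
  by rewrite ratr_sub_eq // => /eqP.
apply/matrixP => y z; rewrite lie_diag mxE.
case: (eqVneq (x y z) 0) => [->|xyz]; first by rewrite !mulr0.
by congr (_ * _); apply/eqP; rewrite ratr_sub_eq //; apply/eqP/xE.
Qed.

(** The two terms are the two routes from [z] to [y]: translate by [e] and then by [d], or in the
    other order. *)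
Lemma lie_model f s e y z : supported f ->
  lie (model_mx f) (shift s e) y z =
  ((lab y).2 == (lab z).2 + e + d)%:R *
  (s (lab z).2 * gauge ((lab z).2 + e) * f (lab z).1 (lab y).1 ((lab z).2 + e)
   - s ((lab z).2 + d) * gauge (lab z).2 * f (lab z).1 (lab y).1 (lab z).2).
Proof.
move=> sf; rewrite lieE mulrBr; congr (_ - _).
  under eq_bigr => u _ do rewrite [shift _ _ _ _]mxE mulrCA.
  by rewrite -mulr_sumr sum_model_r // mulrCA; congr (_ * _); rewrite mulrA.
(* The row of the translation is rewritten as a delta function of the column index, ready for
   [sum_model_l]. *)
have E u : shift s e y u =
    s ((lab y).2 - e) * (lab u == ((lab y).1, (lab y).2 - e))%:R.
  rewrite mxE.
  have -> : (lab u == ((lab y).1, (lab y).2 - e)) =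
      (lab y == ((lab u).1, (lab u).2 + e)).
    case: (lab u) (lab y) => [k a] [k' a'] /=.
    by rewrite !xpair_eqE eq_sym (eq_sym a) subr_eq.
  by case: eqP => [->|]; rewrite ?mulr0 //= addrK.
under eq_bigr => u _ do rewrite E mulrAC -mulrA.
rewrite -mulr_sumr sum_model_l // subr_eq (addrAC _ d e).
by case: eqP => [->|]; rewrite ?mul0r ?mulr0 // !mul1r addrAC addrK mulrA.
Qed.

(** Guarantees that the exponents passed to [sgnpow], in the steps for types B and D and in the form
    for type C, are integers. *)
Definition parity_ok := forall k a, a \in tnth G k ->
  match t with
  | typeA => True
  | typeB | typeD => height a \is a Num.int
  | typeC => height a + 2^-1 \is a Num.int
  end.

Lemma heightD a b : height (a + b) = height a + height b.
Proof. by rewrite /height /=; ring. Qed.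

Lemma heightN a : height (- a) = - height a.
Proof. by rewrite /height /= opprD. Qed.

Lemma height_step b : height (step b) = 1.
Proof. by case: b; rewrite /height /= ?addr0 ?add0r. Qed.

Lemma odd_integer1 : odd_integer 1.
Proof. by rewrite /odd_integer rpred1 floor1. Qed.

Definition type_sign (a : point) : K :=
  if t is typeC then sgnpow K (height a + 2^-1) else 1.

(* Minus [(-1)^(p+q)]. *)
Definition flip_sign : K := if odd_integer (height d) then 1 else -1.

Hypothesis parG : parity_ok.

(** In types B and D, translation by [d] changes the sign of a step by [(-1)^(height d)]. The gauge
    changes by the same factor across a step, since a step changes the parity of the height. *)
Lemma step_sign_gauge k l a b : a \in tnth G k -> a + step b + d \in tnth G l ->
  step_sign b a * gauge (a + step b) = step_sign b (a + d) * gauge a.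
Proof.
move=> /parG aZ /parG bZ; rewrite /step_sign /gauge.
have [bt|_] := boolP (alternating_signs t); last by [].
have {}aZ : height a \is a Num.int by case: (t) bt aZ.
have {}bZ : height d \is a Num.int.
  have {}bZ : height (a + step b + d) \is a Num.int by case: (t) bt bZ.
  rewrite (_ : height d = height (a + step b + d) - height a - 1);
    first by rewrite !rpredB ?rpred1.
  by rewrite !heightD height_step; ring.
have cZ : ((~~ b)%:R : rat) \is a Num.int by case: b.
rewrite !heightD height_step; move: (height a) (height d) aZ bZ => m n mZ nZ.
rewrite !sgnpowE ?rpredD //.
rewrite !odd_integerD ?rpredD ?rpred1 //.
rewrite odd_integer1 -!signr_addb; congr (_ ^+ nat_of_bool _).
by case: (odd_integer m) (odd_integer n) (odd_integer _%:R) => -[] [].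
Qed.

(** The factor [- flip_sign] is [(-1)^(height d)]. In types B and D it comes from the gauge, because
    [a] and [- a - d] have heights of different parity when [height d] is odd; in type C it comes
    from the form. *)
Lemma type_sign_gauge k l a : t <> typeA ->
  a \in tnth G k -> a + d \in tnth G l ->
  type_sign (a + d) * gauge a = - flip_sign * type_sign a * gauge (- a - d).
Proof.
move=> tA /parG aZ /parG bZ; rewrite /type_sign /gauge /flip_sign.
have uE : - (if odd_integer (height d) then 1 else -1) =
    (-1) ^+ odd_integer (height d) :> K by case: ifP; rewrite ?opprK.
have dE : height d = height (a + d) - height a by rewrite heightD; ring.
have intCase : height a \is a Num.int -> height (a + d) \is a Num.int ->
    1 * (-1) ^+ [&& true, odd_integer (height d) & odd_integer (height a)] =
    (-1) ^+ odd_integer (height d) * 1 * (-1) ^+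
      [&& true, odd_integer (height d) & odd_integer (height (- a - d))] :> K.
  move=> {}aZ {}bZ; have dZ : height d \is a Num.int by rewrite dE rpredB.
  rewrite heightD !heightN; move: (height a) (height d) aZ dZ => m n mZ nZ.
  rewrite odd_integerD ?rpredN // !odd_integerN.
  rewrite mulr1 mul1r -!signr_addb; congr (_ ^+ nat_of_bool _).
  by case: (odd_integer m) (odd_integer n) => -[].
rewrite uE; case: (t) tA aZ bZ => // _ aZ bZ; try exact: intCase.
have dZ : height d \is a Num.int.
  rewrite (_ : height d = height (a + d) + 2^-1 - (height a + 2^-1)) ?rpredB //.
  by rewrite dE; ring.
rewrite heightD addrAC !mulr1; move: (_ + 2^-1) (height d) aZ dZ => m n mZ nZ.
by rewrite !sgnpowE ?rpredD // odd_integerD // signr_addb mulrC.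
Qed.

End Degree.

(** * The scalar equations equivalent to membership in the centralizer *)

Section Characterization.

Variables (K : closedFieldType) (charK : [pchar K] =i pred0).
Variables (t : classical_type) (G : diagrams) (d : point).
Hypotheses (d0 : d != 0) (parG : parity_ok t G).
Hypothesis symG : t <> typeA -> forall k, centrally_symmetric (tnth G k).

Let mx := model_mx (K := K) t G d.

Lemma sign_neq0 (b : bool) : (-1) ^+ b != 0 :> K.
Proof. by rewrite signr_eq0. Qed.

Lemma gauge_neq0 a : gauge K t d a != 0.
Proof. exact: sign_neq0. Qed.

Lemma step_sign_neq0 b a : step_sign K t b a != 0.
Proof.
rewrite /step_sign; case: ifP => _; last exact: oner_neq0.
by rewrite /sgnpow expfz_neq0 // oppr_eq0 oner_neq0.
Qed.

Lemma type_sign_neq0 a : type_sign K t a != 0.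
Proof.
rewrite /type_sign; case: (t); rewrite ?oner_neq0 //.
by rewrite /sgnpow expfz_neq0 // oppr_eq0 oner_neq0.
Qed.

Lemma model_mx_degree (f : 'I_3 -> 'I_3 -> point -> K) y z :
  mx f y z != 0 -> (lab y).2 = (lab z).2 + d.
Proof. by rewrite mxE; case: ((lab y).2 =P _) => // _; rewrite mul0r eqxx. Qed.

(** By [step_sign_gauge] both routes in [lie_model] carry the same nonzero sign, which cancels. *)
Lemma lie_step_model f b : supported G d f ->
  lie (mx f) (shift G (step_sign K t b) (step b)) = 0 <->
  forall k l a, a \in tnth G k -> a + step b + d \in tnth G l ->
    f k l (a + step b) = f k l a.
Proof.
move=> sf; split=> [/matrixP fE k l a aG bG|fE].
  have [[z zE] [y yE]] := (lab_surj aG, lab_surj bG).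
  have := fE y z; rewrite lie_model // mxE zE yE /= eqxx mul1r.
  rewrite (step_sign_gauge K parG aG bG) -mulrBr => /eqP.
  by rewrite !mulf_eq0 (negPf (step_sign_neq0 _ _)) (negPf (gauge_neq0 _)) subr_eq0
    => /eqP.
apply/matrixP => y z; rewrite lie_model // [RHS]mxE.
case: eqP => [E|_]; last by rewrite mul0r.
have aG := lab_mem z; have bG := lab_mem y; rewrite E in bG.
by rewrite (step_sign_gauge K parG aG bG) (fE _ _ _ aG bG) subrr mulr0.
Qed.

Lemma gramE a b : gram K t G a b =
  type_sign K t (lab a).2 * (lab a == ((lab b).1, - (lab b).2))%:R.
Proof.
rewrite mxE /type_sign; case: (lab a) (lab b) => [k [i j]] [m [i' j']] /=.
rewrite -mulrA -mulrA -!natrM !mulnb; congr (_ * (nat_of_bool _)%:R).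
by rewrite !xpair_eqE /= andbA andbC.
Qed.

(** This is [(x v_y, v_z) + (v_y, x v_z)]. The form pairs a point only with its opposite, so both
    terms are confined to pairs with [- z = y + d]. *)
Lemma form_model f y z : supported G d f ->
  ((mx f)^T *m gram K t G + gram K t G *m mx f) y z =
  (- (lab z).2 == (lab y).2 + d)%:R *
  (type_sign K t ((lab y).2 + d) * gauge K t d (lab y).2 *
     f (lab y).1 (lab z).1 (lab y).2
   + type_sign K t (lab y).2 * gauge K t d (- (lab y).2 - d) *
     f (lab z).1 (lab y).1 (- (lab y).2 - d)).
Proof.
move=> sf; rewrite mxE mulrDr; congr (_ + _); rewrite mxE.
  have E u : gram K t G u z =
      type_sign K t (- (lab z).2) * (lab u == ((lab z).1, - (lab z).2))%:R.
    by rewrite gramE; case: eqP => [->|]; rewrite ?mulr0.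
  under eq_bigr => u _ do rewrite E mulrCA [_^T _ _]mxE.
  rewrite -mulr_sumr sum_model_l //.
  by case: eqP => [->|]; rewrite ?mul0r ?mulr0 // !mul1r mulrA.
have E u : gram K t G y u =
    type_sign K t (lab y).2 * (lab u == ((lab y).1, - (lab y).2))%:R.
  rewrite gramE; congr (_ * (nat_of_bool _)%:R).
  case: (lab u) (lab y) => [k a] [k' a'] /=.
  by rewrite !xpair_eqE eq_sym -eqr_oppLR (eq_sym a).
under eq_bigr => u _ do rewrite E mulrAC -mulrA.
rewrite -mulr_sumr sum_model_l //.
have -> : (- (lab y).2 == (lab z).2 + d) = (- (lab z).2 == (lab y).2 + d).
  rewrite -subr_eq0 -[RHS]subr_eq0 !opprD !addrA.
  by rewrite (addrC (- (lab y).2)).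
case: eqP => [E'|]; last by rewrite !mul0r mulr0.
have -> : - (lab y).2 - d = (lab z).2 by rewrite -opprD -E' opprK.
by rewrite !mul1r mulrA.
Qed.

Lemma form_model_eq0 f : t <> typeA -> supported G d f ->
  (mx f)^T *m gram K t G + gram K t G *m mx f = 0 <->
  forall k l a, f l k (- a - d) = flip_sign K d * f k l a.
Proof.
move=> tA sf.
have memN k a : (- a \in tnth G k) = (a \in tnth G k).
  by rewrite -in_sigma symG.
have uu : flip_sign K d * flip_sign K d = 1.
  by rewrite /flip_sign; case: ifP; rewrite ?mulrNN mulr1.
have u0 : flip_sign K d != 0.
  by rewrite /flip_sign; case: ifP; rewrite ?oppr_eq0 oner_eq0.
(* All signs factor out, using that [flip_sign] squares to 1, and a single linear relation between
   the two scalars remains. *)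
have cond k l a (x y : K) : a \in tnth G k -> a + d \in tnth G l ->
    type_sign K t (a + d) * gauge K t d a * x
    + type_sign K t a * gauge K t d (- a - d) * y =
    - flip_sign K d * type_sign K t a * gauge K t d (- a - d) *
       (x - flip_sign K d * y).
  move=> aG bG; rewrite (type_sign_gauge K parG tA aG bG).
  rewrite -[X in _ + X]mul1r -uu; ring.
split=> [/matrixP fE k l a|fE].
  have [xa|] := boolP ((a \in tnth G k) && (a + d \in tnth G l)).
    case/andP: xa => aG bG; have zG : - (a + d) \in tnth G l by rewrite memN.
    have [[y yE] [z zE]] := (lab_surj aG, lab_surj zG).
    have := fE y z; rewrite form_model // mxE yE zE /= opprK eqxx mul1r.
    rewrite (cond k l) // => /eqP; rewrite !mulf_eq0 oppr_eq0 (negPf u0).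
    rewrite (negPf (type_sign_neq0 _)) (negPf (gauge_neq0 _)) /= subr_eq0.
    by move=> /eqP ->; rewrite mulrA uu mul1r.
  (* Off the support both scalars vanish, as central symmetry makes the two support conditions
     equivalent. *)
  move=> nG; suff [-> ->] : f l k (- a - d) = 0 /\ f k l a = 0 by rewrite mulr0.
  split; apply: contraNeq nG => /sf[]; last by move=> -> ->.
  by rewrite subrK -opprD !memN => -> ->.
apply/matrixP => y z; rewrite form_model // [RHS]mxE.
case: eqP => [E|_]; last by rewrite mul0r.
have aG := lab_mem y; have := lab_mem z; rewrite -memN E => bG.
by rewrite (cond _ _ _ _ _ aG bG) fE mulrA uu mul1r subrr !mulr0.
Qed.

Definition solution (f : 'I_3 -> 'I_3 -> point -> K) : Prop :=
  (forall k l, intertwiner (tnth G k) (tnth G l) d (f k l)) /\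
  (t <> typeA -> forall k l a, f l k (- a - d) = flip_sign K d * f k l a).

Lemma in_gP f : supported G d f -> in_g t (mx f) <->
  (t <> typeA -> forall k l a, f l k (- a - d) = flip_sign K d * f k l a).
Proof.
move=> sf; have [tA|tA] : t = typeA \/ t <> typeA by case: (t); [left|right..].
  (* In type A the trace condition is automatic: a map of nonzero degree has zero diagonal. *)
  split=> // _; rewrite /in_g tA; apply/eqP/big1 => y _.
  case: (eqVneq (mx f y y) 0) => // /model_mx_degree/eqP.
  by rewrite addrC -subr_eq subrr eq_sym (negPf d0).
have -> : in_g t (mx f) =
    ((mx f)^T *m gram K t G + gram K t G *m mx f == 0).
  by move: tA; rewrite /in_g; case: (t).
by split=> [/eqP/(form_model_eq0 tA sf) //|/(_ tA)/(form_model_eq0 tA sf)/eqP].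
Qed.

Lemma model_mx_in_Zpq f : supported G d f ->
  mx f \in Zpq K t G d.1 d.2 <-> solution f.
Proof.
move=> sf.
have degx : lie (h1 K G) (mx f) == ratr d.1 *: mx f.
  rewrite h1E; apply/eqP/(lie_diag_eq charK) => y z /model_mx_degree ->.
  by rewrite /= addrAC subrr add0r.
have degy : lie (h2 K G) (mx f) == ratr d.2 *: mx f.
  rewrite h2E; apply/eqP/(lie_diag_eq charK) => y z /model_mx_degree ->.
  by rewrite /= addrAC subrr add0r.
rewrite !inE degx degy andbT andbT e1E e2E.
split.
  case/and3P => /(in_gP sf) gf.
  move=> /eqP/(lie_step_model _ sf) f1 /eqP/(lie_step_model _ sf) f2.
  split=> // k l; split=> [a|a []]; [exact: sf|exact: f1|exact: f2].
case=> fI /(in_gP sf) -> /=.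
apply/andP; split; apply/eqP/(lie_step_model _ sf) => k l a.
  by have [_] := fI k l; apply.
by have [_] := fI k l; apply.
Qed.

(** The two eigenvalue equations kill every entry that does not translate points by [d]. The scalars
    are the remaining entries times the gauge, which is its own inverse. *)
Lemma Zpq_model_mx x : x \in Zpq K t G d.1 d.2 ->
  exists2 f, supported G d f & x = mx f.
Proof.
rewrite inE h1E h2E.
case/and3P => _ /eqP/(lie_diag_eq charK) x1 /eqP/(lie_diag_eq charK) x2.
(* The delta sums extract the entry from [(k, a)] to [(l, a + d)] and give 0 when either point is
   missing. *)
pose f k l a : K := gauge K t d a *
  \sum_z (\sum_y x y z * (lab y == (l, a + d))%:R) * (lab z == (k, a))%:R.
exists f.
  move=> k l a; rewrite /f mulf_eq0 negb_or gauge_neq0 /= => fkl.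
  split; apply: contraNT fkl => nG; first by rewrite sum_lab0.
  by rewrite big1 // => z _; rewrite sum_lab0 // mul0r.
apply/matrixP => y z; rewrite mxE /f; case: eqP => [E|nE].
  have pE u : lab u = ((lab u).1, (lab u).2) by case: (lab u).
  by rewrite -E -!pE !sum_lab mul1r mulrA gaugeK mul1r.
rewrite mul0r; apply: contra_notP nE => /eqP xyz.
have := x1 _ _ xyz; have := x2 _ _ xyz.
case: (lab y).2 (lab z).2 => [i j] [i' j'] /= jE iE.
by apply/eqP; rewrite addrC -subr_eq (surjective_pairing d) -iE -jE.
Qed.

End Characterization.

(** * The basis *)

Section Basis.

Variables (K : closedFieldType) (charK : [pchar K] =i pred0).
Variables (t : classical_type) (G : diagrams) (d : point).
Hypotheses (d0 : d != 0) (parG : parity_ok t G).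
Hypothesis sG : forall k, skew_diagram0 (tnth G k).
Hypothesis symG : t <> typeA -> forall k, centrally_symmetric (tnth G k).

Lemma lie_linear (c : K) (x y e : 'M[K]_(dimV G)) :
  lie (c *: x + y) e = c *: lie x e + lie y e.
Proof.
rewrite /lie mulmxDl mulmxDr -scalemxAl -scalemxAr scalerBr.
by rewrite opprD addrACA.
Qed.

Lemma lie_linear_r (c : K) (x y e : 'M[K]_(dimV G)) :
  lie e (c *: x + y) = c *: lie e x + lie e y.
Proof.
rewrite /lie mulmxDl mulmxDr -scalemxAl -scalemxAr scalerBr.
by rewrite opprD addrACA.
Qed.

Lemma Zpq_linear p q c x y : x \in Zpq K t G p q -> y \in Zpq K t G p q ->
  c *: x + y \in Zpq K t G p q.
Proof.
have glin : in_g t x -> in_g t y -> in_g t (c *: x + y).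
  have lin : x^T *m gram K t G + gram K t G *m x == 0 ->
      y^T *m gram K t G + gram K t G *m y == 0 ->
      (c *: x + y)^T *m gram K t G + gram K t G *m (c *: x + y) == 0.
    move=> /eqP x0 /eqP y0.
    rewrite linearP /= mulmxDl mulmxDr -scalemxAl -scalemxAr addrACA -scalerDr.
    by rewrite x0 y0 scaler0 addr0.
  rewrite /in_g; move: lin; case: (t) => // _ /eqP x0 /eqP y0.
  by rewrite linearP /= x0 y0 mulr0 addr0.
rewrite !inE => /and3P[/and3P[xg /eqP x1 /eqP x2] /eqP x3 /eqP x4].
move=> /and3P[/and3P[yg /eqP y1 /eqP y2] /eqP y3 /eqP y4].
rewrite glin // !lie_linear !lie_linear_r x1 x2 x3 x4 y1 y2 y3 y4.
by rewrite !scaler0 !addr0 !scalerDr !scalerA ![c * _]mulrC !eqxx.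
Qed.

Definition block_good (B : 'I_3 * 'I_3 * {fset point}) : Prop :=
  good (tnth G B.1.1) (tnth G B.1.2) d B.2.

Lemma block_good_mem k l C a : block_good (k, l, C) -> a \in C ->
  a \in tnth G k /\ a + d \in tnth G l.
Proof. by move=> /goodP[] // _ _ H _ _ /H. Qed.

Lemma solution_supported (f : 'I_3 -> 'I_3 -> point -> K) :
  solution t G d f -> supported G d f.
Proof. by case=> fI _ k l a; have [fS _] := fI k l; apply: fS. Qed.

(** One point chosen in each block [B i] supplies the matrix position that [basis_of_entries] asks
    for. It remains to exhibit solutions dual to the blocks and to show that a nonzero solution is
    nonzero all over some block. *)
Lemma Zpq_basis (I : finType) (B : I -> 'I_3 * 'I_3 * {fset point})
    (f : I -> 'I_3 -> 'I_3 -> point -> K) :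
  (forall i, block_good (B i)) -> (forall i, solution t G d (f i)) ->
  (forall i j a, a \in (B j).2 ->
     (f i (B j).1.1 (B j).1.2 a != 0) = (i == j)) ->
  (forall (g : 'I_3 -> 'I_3 -> point -> K) k l a,
     solution t G d g -> g k l a != 0 ->
     exists i, forall b, b \in (B i).2 -> g (B i).1.1 (B i).1.2 b != 0) ->
  exists b : I -> 'M[K]_(dimV G),
    free (codom b) /\ <<codom b>>%VS =i Zpq K t G d.1 d.2.
Proof.
move=> Bgood fsol fdiag fsep.
have ex_entry i : exists r : 'I_(dimV G) * 'I_(dimV G) * point,
    [/\ r.2 \in (B i).2, lab r.1.1 = ((B i).1.2, r.2 + d) &
         lab r.1.2 = ((B i).1.1, r.2)].
  have := Bgood i; case: (B i) => -[k l] C gC.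
  have /goodP[] // := gC; move=> /fset0Pn[a aC] _ _ _ _.
  have [aG bG] := block_good_mem gC aC.
  by have [[z zE] [y yE]] := (lab_surj aG, lab_surj bG); exists (y, z, a).
have [r rP] := boolp.choice ex_entry.
have entry (g : 'I_3 -> 'I_3 -> point -> K) i :
    (model_mx t G d g (r i).1.1 (r i).1.2 != 0) =
    (g (B i).1.1 (B i).1.2 (r i).2 != 0).
  have [_ yE zE] := rP i; rewrite mxE yE zE /= eqxx mul1r mulf_eq0.
  by rewrite (negPf (gauge_neq0 _ _ _ _)).
exists (fun i => model_mx t G d (f i)).
apply: (@basis_of_entries _ _ _ (Zpq K t G d.1 d.2) _ (fun i => (r i).1)).
- have -> : 0 = model_mx t G d (fun _ _ _ => 0) :> 'M[K]_(dimV G).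
    by apply/matrixP => y z; rewrite !mxE !mulr0.
  have s0 : supported G d (fun _ _ _ => 0 : K) by move=> k l a; rewrite eqxx.
  apply/(model_mx_in_Zpq charK d0 parG symG s0); split.
    by move=> k l; split=> [a|//]; rewrite eqxx.
  by move=> _ k l a; rewrite mulr0.
- by move=> c x y; apply: Zpq_linear.
- move=> i; have fS := solution_supported (fsol i).
  apply/(model_mx_in_Zpq charK d0 parG symG fS).
  exact: fsol.
- by move=> i j; rewrite entry fdiag //; have [] := rP j.
move=> x xZ; have [g gs xE] := Zpq_model_mx charK xZ.
have gsol : solution t G d g.
  by apply/(model_mx_in_Zpq charK d0 parG symG gs); rewrite -xE.
move=> x0; have [[y z] xyz] : exists u : 'I_(dimV G) * 'I_(dimV G), x u.1 u.2 != 0.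
  apply: contrapT => nx; case/negP: x0; apply/eqP/matrixP => y z.
  by rewrite [RHS]mxE; apply: contra_notP nx => /eqP xyz; exists (y, z).
move: xyz; rewrite xE mxE /= !mulf_eq0 !negb_or => /and3P[_ _ /(fsep _ _ _ _ gsol)].
by case=> i gi; exists i; rewrite entry gi //; have [] := rP i.
Qed.

Definition block_ind (k l : 'I_3) (C : {fset point})
    (k' l' : 'I_3) (a : point) : K :=
  [&& k' == k, l' == l & a \in C]%:R.

Lemma block_ind_intertwiner k l C k' l' : block_good (k, l, C) ->
  intertwiner (tnth G k') (tnth G l') d (block_ind k l C k' l').
Proof.
move=> gC; rewrite /block_ind.
case: (eqVneq k' k) => [->|_]; last by split=> // a; rewrite eqxx.
case: (eqVneq l' l) => [->|_]; last by split=> // a; rewrite eqxx.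
exact: intertwiner_indicator.
Qed.

Lemma intertwinerD X Y (c : K) f g : intertwiner X Y d f -> intertwiner X Y d g ->
  intertwiner X Y d (fun a => f a + c * g a).
Proof.
move=> [fS fE] [gS gE]; split=> [a|a b aX bY]; last by rewrite fE // gE.
by case: (eqVneq (f a) 0) => [->|/fS //]; rewrite add0r mulf_eq0 => /norP[_ /gS].
Qed.

(** * Types B, C and D: blocks up to reflection *)

Section Symmetric.

Hypothesis tA : t <> typeA.

(** The indicator of a block symmetrized under [a |-> - a - d]. On a block equal to its own flip the
    value is 2 or 0, according to [flip_sign]. *)
Definition block_elem (k l : 'I_3) C k' l' a : K :=
  block_ind k l C k' l' a + flip_sign K d * block_ind l k (flip d C) k' l' a.

Lemma block_good_flip k l C : block_good (k, l, C) -> block_good (l, k, flip d C).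
Proof. by apply: good_flip; apply: symG. Qed.

Lemma block_elem_solution k l C : block_good (k, l, C) ->
  solution t G d (block_elem k l C).
Proof.
move=> gC; split=> [k' l'|_ k' l' a].
  apply: intertwinerD; apply: block_ind_intertwiner => //.
  exact: block_good_flip.
have E k1 l1 C1 k2 l2 : block_ind k1 l1 C1 l2 k2 (- a - d) =
    block_ind l1 k1 (flip d C1) k2 l2 a.
  by rewrite /block_ind in_flip andbCA.
rewrite /block_elem !E flipK mulrDr mulrA addrC; congr (_ + _).
by rewrite /flip_sign; case: ifP => _; rewrite ?mulrNN !mul1r.
Qed.

Lemma two_neq0 : 1 + 1 != 0 :> K.
Proof.
have /(_ 2%N) H n : ((n%:R : K) == 0) = (n == 0)%N by move: n; apply/pcharf0P.
by rewrite -[1 + 1]/(2%:R) H.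
Qed.

(** The index set is the same in types B, C and D; naming [typeB] makes it compute to the sum
    type. *)
Let I := E G d.1 d.2 typeB.

(** A relation and not a function: an unordered pair is represented by either of its members, [C] or
    [flip d C]. *)
Definition indexes (i : I) (k l : 'I_3) (C : {fset point}) : Prop :=
  [/\ block_good (k, l, C), (k <= l)%N,
      k = l -> C = flip d C -> odd_integer (height d) &
      match i with
      | inl u => [/\ tag u = k, k = l & val (tagged u) = [fset C; flip d C]]
      | inr u => val (tag u) = (k, l) /\ val (tagged u) = (C, flip d C)
      end].

Lemma indexes_ex (i : I) : exists B, indexes i B.1.1 B.1.2 B.2.
Proof.
case: i => [[k [S SE]]|[[[k l] kl] [[C C'] CE]]].
  have /imfset2P[C /= C_ [C' /= + SC]] := SE.
  move: C_; rewrite !inE /= => /andP[_ /asboolP C1] /andP[/andP[_ /asboolP C2]].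
  case/andP => /eqP CC' CC.
  have [gC C'E] :=
    (@opposite_pairP _ _ d C C' (symG tA k)).1 (conj C1 (conj C2 CC')).
  exists (k, k, C); split=> //=; last by rewrite -C'E.
  by move=> _ CE; apply: (implyP CC); rewrite C'E -CE.
have CE' := CE; rewrite !inE /= in CE'.
case/andP: CE' => /andP[/andP[_ /asboolP C1] /andP[_ /asboolP C2]] /eqP CC'.
have [gC C'E] :=
  (@opposite_pairP _ _ d C C' (symG tA l)).1 (conj C1 (conj C2 CC')).
exists (k, l, C); split=> //=; [exact: ltnW| |by rewrite C'E].
by move=> kE; have := kl; rewrite /= kE ltnn.
Qed.

Lemma indexes_surj k l C : block_good (k, l, C) -> (k <= l)%N ->
  (k = l -> C = flip d C -> odd_integer (height d)) ->
  exists i, indexes i k l C.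
Proof.
move=> gC kl odC.
have [C1 [C2 CC']] :=
  (@opposite_pairP _ _ d C (flip d C) (symG tA l)).2 (conj gC erefl).
have memS D X : skew_subdiagram X D -> D \in skew_subdiagrams X.
  by move=> sD; have [DX _ _] := sD; rewrite !inE /= fpowersetE DX; apply/asboolP.
move: kl; rewrite leq_eqVlt => /orP[/eqP/val_inj kl|kl].
  have SE : [fset C; flip d C] \in E_unordered G d.1 d.2 k.
    apply/imfset2P; exists C; first exact: memS.
    exists (flip d C) => //; rewrite inE /= memS ?CC' ?eqxx /= ?kl //.
    by apply/implyP => /eqP; apply: odC.
  exists (inl (Tagged (fun k => E_unordered G d.1 d.2 k) [` SE])).
  by split=> //=; rewrite kl.
have SE : (C, flip d C) \in E_pairs G d.1 d.2 k l.
  have := memS _ _ C1; have := memS _ _ C2.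
  by rewrite !inE /= CC' eqxx => -> ->.
exists (inr (existT (fun kl : {kl : 'I_3 * 'I_3 | (kl.1 < kl.2)%N} =>
  E_pairs G d.1 d.2 (val kl).1 (val kl).2 : Type) (exist _ (k, l) kl) [` SE])).
by split=> //=; apply: ltnW.
Qed.

(** Blocks in one orbit of the reflection share an index. The mixed cases cannot occur, since one
    index has [k = l] and the other [k < l]. *)
Lemma indexes_inj i j k l C k' l' C' : indexes i k l C -> indexes j k' l' C' ->
  (k', l', C') = (k, l, C) \/ (k', l', C') = (l, k, flip d C) -> i = j.
Proof.
move=> [_ kl _ iE] [_ kl' _ jE] CC'.
case: i iE => [[k1 S]|[kl1 S]] /=; case: j jE => [[k2 S']|[kl2 S']] /=.
- case=> k2E k2l' S'E [k1E k1l SE]; subst k2 k1 l l'.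
  have kk' : k' = k by case: CC' => -[].
  subst k'; congr (inl (Tagged _ _)); apply: val_inj.
  apply: (etrans SE); apply/esym/(etrans S'E).
  by case: CC' => -[->] //; rewrite flipK fsetUC.
- case=> E _ [_ kl0 _]; exfalso; subst l.
  case: kl2 E {S'} => -[k3 l3] /= h [? ?]; subst k3 l3.
  by case: CC' => -[] ? ?; subst; rewrite ltnn in h.
- case=> _ kl0 _ [E _]; exfalso; subst l'.
  case: kl1 E {S} => -[k3 l3] /= h [? ?]; subst k3 l3.
  by case: CC' => -[] ? ?; subst; rewrite ltnn in h.
move=> [E' S'E] [E SE].
have ltE (u : {u : 'I_3 * 'I_3 | (u.1 < u.2)%N}) m n : val u = (m, n) -> (m < n)%N.
  by move=> uE; have := valP u; rewrite [\val u]uE.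
have [klt klt'] := (ltE _ _ _ E, ltE _ _ _ E').
case: CC' => -[? ? ?]; subst; last by have := ltn_trans klt klt'; rewrite ltnn.
have E12 : kl1 = kl2 by apply: val_inj; apply: etrans E (esym E').
subst kl2; congr (inr (existT _ _ _)); apply: val_inj.
exact: etrans SE (esym S'E).
Qed.

Lemma indexes_fun i k l C k' l' C' : indexes i k l C -> indexes i k' l' C' ->
  [/\ k' = k, l' = l & C' = C \/ k = l /\ C' = flip d C].
Proof.
case: i => [[k1 S]|[kl1 S]] [_ _ _ /= iE] [_ _ _ /= iE'].
  case: iE iE' => <- <- SE [<- <-]; rewrite SE => CE; split=> //.
  have : C' \in [fset C; flip d C] by rewrite CE !inE eqxx.
  by rewrite !inE => /orP[/eqP ->|/eqP ->]; [left|right].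
case: iE iE' => uE SE [/(etrans (esym uE))[<- <-] /(etrans (esym SE))[<- _]].
by split=> //; left.
Qed.

Lemma Zpq_basis_symmetric : exists b : I -> 'M[K]_(dimV G),
  free (codom b) /\ <<codom b>>%VS =i Zpq K t G d.1 d.2.
Proof.
have [B BP] := boolp.choice indexes_ex.
pose f i := block_elem (B i).1.1 (B i).1.2 (B i).2.
apply: (Zpq_basis (B := B) (f := f)).
- by move=> i; have [+ _ _ _] := BP i; case: (B i) => -[].
- by move=> i; apply: block_elem_solution; have [+ _ _ _] := BP i.
- move=> i j a; have := BP i; have := BP j; rewrite /f.
  case: (eqVneq i j) => [<-|ij].
    case: (B i) => -[k l] C /= [gC _ odC _] _ aC.
    rewrite /block_elem /block_ind !eqxx aC /=.
    (* If [a] also lies in the flipped block, the block equals its flip; the parity condition then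
       makes [flip_sign] equal to 1 and the value 2. *)
    case: and3P => [[/eqP kl _ aC']|_]; last by rewrite mulr0 addr0 oner_eq0.
    subst l; have CE := good_eq (sG k) (sG k) gC (block_good_flip gC) aC aC'.
    by rewrite /flip_sign odC // mulr1 two_neq0.
  case: (B i) (B j) => -[k l] C [[k' l'] C'] /= jB iB aC'.
  apply: contraNF ij => nz; apply/eqP.
  have [[gC' _ _ _] [gC _ _ _]] := (jB, iB).
  (* A nonzero value puts [a] in the block of [i] or in its flip. Good sets that meet coincide, so
     the two indices are equal. *)
  have {nz} : [&& k' == k, l' == l & a \in C]
      || [&& k' == l, l' == k & a \in flip d C].
    apply: contraNT nz => /norP[/negPf nz1 /negPf nz2].
    by rewrite /block_elem /block_ind nz1 nz2 mulr0 addr0.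
  case/orP=> /and3P[/eqP kE /eqP lE aC]; apply: (indexes_inj iB jB); [left|right];
    rewrite kE lE in gC' *; congr (_, _).
    exact: (good_eq (sG k) (sG l) gC' gC aC' aC).
  exact: (good_eq (sG l) (sG k) gC' (block_good_flip gC) aC' aC).
move=> g k l a gsol gkl; have [gI gS] := gsol.
have [C gC aC] := intertwiner_support (sG k) (sG l) (gI k l) gkl.
(* Reflection exchanges [k] and [l], and the symmetry of [g] preserves nonvanishing. *)
wlog kl : k l a C gkl gC aC / (k <= l)%N.
  move=> W; have [kl|/ltnW lk] := leqP k l; first exact: W gkl gC aC kl.
  apply: (W l k (- a - d) (flip d C)) => //.
  - by rewrite gS // mulf_neq0 // /flip_sign; case: ifP; rewrite ?oppr_eq0 oner_eq0.
  - exact: block_good_flip.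
  - by rewrite in_flip opprD !opprK addrK.
have gconst := intertwiner_const (sG k) (sG l) (gI k l) gC.
(* Otherwise [g] takes the same value at [a] and [- a - d], which lie in one block, while the
   symmetry makes these values opposite; so [2 * g a = 0]. *)
have odC : k = l -> C = flip d C -> odd_integer (height d).
  move=> kE CE; apply: contraNT gkl => ev.
  have a'C : - a - d \in C by rewrite CE in_flip opprD !opprK addrK.
  have := gS tA k l a; rewrite -kE in gconst *; rewrite -(gconst a) //.
  rewrite /flip_sign (negPf ev) mulN1r => /eqP.
  by rewrite -subr_eq0 opprK -mulr2n -mulr_natl mulf_eq0 (negPf two_neq0) /= => ->.
have [i iC] := indexes_surj gC kl odC; exists i => b.
have gC0 : {in C, forall c, g k l c != 0}.
  by move=> c cC; rewrite -(gconst a).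
(* The representative chosen for [i] may be the flip of [C]; the symmetry of [g] covers that
   case. *)
have := BP i; case: (B i) => -[k' l'] C' /= iC'.
have [-> -> [-> /gC0 //|[kE ->]]] := indexes_fun iC iC'.
rewrite in_flip => /gC0; rewrite -kE gS // mulf_eq0 => /norP[_].
by [].
Qed.

End Symmetric.

(** Without a form to respect, the indicators themselves are the solutions, and the empty diagrams
    force every block to go from the first diagram to itself. *)
Lemma Zpq_basis_typeA : t = typeA -> (forall k, k != ord0 -> tnth G k = fset0) ->
  exists b : E_single G d.1 d.2 ord0 -> 'M[K]_(dimV G),
    free (codom b) /\ <<codom b>>%VS =i Zpq K t G d.1 d.2.
Proof.
move=> tA G0.
have goodE (C : E_single G d.1 d.2 ord0) : block_good (ord0, ord0, val C).
  have := valP C; rewrite !inE /= => /andP[/andP[_ /asboolP sC] /asboolP sC'].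
  by split.
apply: (Zpq_basis (B := fun C => (ord0, ord0, val C))
                  (f := fun C => block_ind ord0 ord0 (val C))) => //.
- by move=> C; split=> [k l|]; [exact: block_ind_intertwiner|rewrite tA].
- move=> C C' a /= aC'; rewrite /block_ind !eqxx /=.
  case: (boolP (a \in val C)) => aC.
    rewrite oner_eq0; apply/esym/eqP/val_inj.
    exact: (good_eq (sG ord0) (sG ord0) (goodE C) (goodE C') aC aC').
  by rewrite eqxx; apply/esym/negbTE; apply: contraNneq aC => ->.
move=> g k l a [gI _] gkl; have [gS _] := gI k l.
have [aG bG] := gS _ gkl.
have k0 : k = ord0 by apply: contraTeq aG => /G0 ->; rewrite in_fset0.
have l0 : l = ord0 by apply: contraTeq bG => /G0 ->; rewrite in_fset0.
subst k l; have [C gC aC] := intertwiner_support (sG _) (sG _) (gI _ _) gkl.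
have CE : C \in E_single G d.1 d.2 ord0.
  have [C1 C2] := gC; have [CX _ _] := C1.
  by rewrite !inE /= fpowersetE CX /=; apply/andP; split; apply/asboolP.
exists [` CE] => b bC.
by rewrite (intertwiner_const (sG _) (sG _) (gI _ _) gC bC aC).
Qed.

End Basis.

(** * Skewness, symmetry and parity of the model diagrams *)

Lemma tnth3_ind (P : {fset point} -> Prop) G1 G2 G3 : P G1 -> P G2 -> P G3 ->
  forall k, P (tnth [tuple G1; G2; G3] k).
Proof. by move=> P1 P2 P3 [[|[|[|]]] //] i; rewrite (tnth_nth fset0). Qed.

Lemma coset_height (x y : rat) X a : in_coset x y X -> a \in X ->
  height a - (x + y) \is a Num.int.
Proof.
move=> cX /cX[h1 h2].
have -> : height a - (x + y) = (a.1 - x) + (a.2 - y) by rewrite /height; ring.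
exact: rpredD.
Qed.

Lemma integral_height X a : integral X -> a \in X -> height a \is a Num.int.
Proof. by move=> iX /(coset_height iX); rewrite [0 + 0]addr0 subr0. Qed.

Lemma non_integral_height X a : non_integral X -> a \in X ->
  height a \is a Num.int.
Proof.
move=> nX /(coset_height nX); rewrite (_ : 2^-1 + 2^-1 = 1 :> rat) //.
by move=> h; rewrite -[height a](subrK 1) rpredD ?rpred1.
Qed.

Lemma half_coset_height x y X a : x + y = 2^-1 -> in_coset x y X -> a \in X ->
  height a + 2^-1 \is a Num.int.
Proof.
move=> xy cX /(coset_height cX); rewrite xy => h.
have -> : height a + 2^-1 = (height a - 2^-1) + 1 by move: (height a) => z; field.
by rewrite rpredD ?rpred1.
Qed.

Lemma diagram_data_skew t l G1 G2 G3 : diagram_data t l G1 G2 G3 ->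
  forall k, skew_diagram0 (tnth [tuple G1; G2; G3] k).
Proof.
have skew0 : skew_diagram0 fset0 by left.
case: t => /= -[].
- by move=> s1 _ _ -> ->; apply: tnth3_ind => //; right.
- by move=> [s1 _ _] [s2 _ _] _ ->; apply: tnth3_ind.
- by move=> [s1 _ _] [s2 _ _] _ ->; apply: tnth3_ind.
by move=> [s1 _ _] [s2 _] [s3 _] _ _; apply: tnth3_ind.
Qed.

Lemma diagram_data_symmetric t l G1 G2 G3 : diagram_data t l G1 G2 G3 ->
  t <> typeA -> forall k, centrally_symmetric (tnth [tuple G1; G2; G3] k).
Proof.
have sym0 : centrally_symmetric fset0.
  by apply/fsetP => a; rewrite in_sigma !in_fset0.
case: t => //= -[].
- by move=> [_ s1 _] [_ s2 _] _ -> _; apply: tnth3_ind.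
- by move=> [_ s1 _] [_ s2 _] _ -> _; apply: tnth3_ind.
by move=> [_ s1 _] [_ s2] [_ s3] _ _ _; apply: tnth3_ind.
Qed.

Lemma diagram_data_parity t l G1 G2 G3 : diagram_data t l G1 G2 G3 ->
  parity_ok t [tuple G1; G2; G3].
Proof.
case: t => //= -[].
- move=> [_ _ i1] [_ _ i2] _ -> k a; move: a.
  pose P (X : {fset point}) := forall a, a \in X -> height a \is a Num.int.
  apply: (@tnth3_ind P) k => a //.
    exact: integral_height.
  exact: non_integral_height.
- move=> [_ _ i1] [_ _ i2] _ -> k a; move: a.
  pose P (X : {fset point}) := forall a, a \in X -> height a + 2^-1 \is a Num.int.
  apply: (@tnth3_ind P) k => a //.
    by apply: half_coset_height i1; rewrite add0r.
  by apply: half_coset_height i2; rewrite addr0.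
move=> [_ _ i1] _ _ _ i23 k a; move: a.
pose P (X : {fset point}) := forall a, a \in X -> height a \is a Num.int.
apply: (@tnth3_ind P) k => a.
- exact: non_integral_height.
- by case: i23 => [[-> _] //|[_ [i2 _] _ _]]; apply: integral_height.
by case: i23 => [[_ ->] //|[_ [_ i3] _ _]]; apply: integral_height.
Qed.

Theorem theorem2p9 (K : closedFieldType) (charK : [pchar K] =i pred0)
    (t : classical_type) (l : nat) (G1 G2 G3 : {fset point}) (p q : rat)
    (hl : simple_rank t l) (hG : diagram_data t l G1 G2 G3)
    (hpq : (p, q) <> (0, 0)) :
  let G : diagrams := [tuple G1; G2; G3] in
  exists b : E G p q t -> 'M[K]_(dimV G),
    free (codom b) /\ <<codom b>>%VS =i Zpq K t G p q.
Proof.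
move=> G; have d0 : ((p, q) : point) != 0 by apply/eqP.
have sG := diagram_data_skew hG; have symG := diagram_data_symmetric hG.
have parG := diagram_data_parity hG.
have [tA|tA] : t = typeA \/ t <> typeA by case: (t); [left|right..].
  subst t; apply: (@Zpq_basis_typeA _ charK _ G (p, q)) => //.
  move=> k; have [_ _ _ G2E G3E] := hG; rewrite /G G2E G3E.
  by case: k => [[|[|[|]]] //] i _; rewrite (tnth_nth fset0).
have := @Zpq_basis_symmetric _ charK t G (p, q) d0 parG sG symG tA.
(* Once the type is fixed to B, C or D, [E] computes to its value at [typeB]. *)
by clear hl hG symG parG; case: t tA.
Qed.
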